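(* Let $k\ge 3$, let $g$ be even, and let $\mathbf{a}=(a_1,\ldots,a_k)$ be such that a girth-regular graph of valency $k$, girth $g$ and signature $\mathbf{a}$ exists. Write $s=\sum_{i=1}^k a_i$. If $g\equiv 0\pmod 4$, then $$n(k,g,\mathbf{a})\ge\frac{c(g,k)+s+k^{g}-2c(\tfrac{g}{2},k)k^{\frac{g}{2}}}{c(g,k)-c^2(\tfrac{g}{2},k)+s},\qquad n_2(k,g,\mathbf{a})\ge2\,\frac{c(g,k)+s+k^{g}-2c(\tfrac{g}{2},k)k^{\frac{g}{2}}}{c(g,k)-c^2(\tfrac{g}{2},k)+s}.$$ If $g\equiv 2\pmod 4$, then $$n(k,g,\mathbf{a})\ge\frac{c(g,k)+s+k^g}{c(g,k)+s},\qquad n_2(k,g,\mathbf{a})\ge\frac{2k^g}{c(g,k)+s}.$$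
   Context: All graphs are simple, finite and connected, and valency $k>2$ is assumed throughout. For a $k$-regular graph of girth $g$, the signature of a vertex $v$ is the sequence $(a_1,\ldots,a_k)$, listed in non-decreasing order, of the numbers of $g$-cycles containing each of the $k$ edges incident with $v$; the graph is girth-regular if all vertices have the same signature, which is then called the signature of the graph. $n(k,g,\mathbf{a})$ denotes the smallest order of a girth-regular graph of valency $k$, girth $g$ and signature $\mathbf{a}$, and $n_2(k,g,\mathbf{a})$ the smallest order of such a graph that is bipartite (when one exists). For an even integer $\ell$, $c(\ell,k)$ denotes the number of closed walks of length $\ell$ starting at a given vertex that contain no cycle, i.e. the number of closed walks of length $\ell$ from a fixed vertex in the infinite $k$-regular tree (a polynomial in $k$ of degree $\ell/2$). *)

(* Defs.v *)
From mathcomp Require Import all_boot.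
From mathcomp Require Import boolp.

Set Implicit Arguments.
Unset Strict Implicit.
Unset Printing Implicit Defensive.

Record graph := Graph {
  vertex :> finType;
  adj : rel vertex;
  adj_sym : symmetric adj;
  adj_irr : irreflexive adj;
  adj_conn : forall x y : vertex, connect adj x y }.

Definition graph_order (G : graph) : nat := #|G|.

Definition neighbours (G : graph) (v : G) : {set G} := [set w | adj v w].

Definition regular (k : nat) (G : graph) : Prop :=
  forall v : G, #|neighbours v| = k.

Definition bipartite (G : graph) : Prop :=
  exists A : {set G}, forall x y : G, adj x y -> (x \in A) != (y \in A).

(* The size condition excludes the sequences of length 0, 1 and 2, which
   [ucycle] accepts. *)
Definition is_cycle (G : graph) (c : seq G) : bool :=
  (2 < size c) && ucycleb (@adj G) c.

Definition has_girth (g : nat) (G : graph) : Prop :=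
  (exists2 c : seq G, is_cycle c & size c = g) /\
  (forall c : seq G, is_cycle c -> g <= size c).

Definition cycle_edges (G : graph) (c : seq G) : {set {set G}} :=
  [set [set x; next c x] | x in c].

(* Cycles are counted as subgraphs, each identified with its set of edges,
   so that the choice of starting point and direction is immaterial. *)
Definition cycles (g : nat) (G : graph) : {set {set {set G}}} :=
  [set cycle_edges t | t : g.-tuple G & is_cycle t].

Definition edge_cycles (g : nat) (G : graph) (u v : G) : nat :=
  #|[set C in cycles g G | [set u; v] \in C]|.

Definition signature (g : nat) (G : graph) (v : G) : seq nat :=
  sort leq [seq edge_cycles g v w | w <- enum (neighbours v)].

Definition girth_regular (k g : nat) (a : k.-tuple nat) (G : graph) : Prop :=
  [/\ regular k G, has_girth g G & forall v : G, signature g v = a].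

Definition bip_girth_regular (k g : nat) (a : k.-tuple nat) (G : graph) : Prop :=
  girth_regular g a G /\ bipartite G.

Fact order_exists (P : graph -> Prop) :
  (exists G, P G) -> exists n, `[< exists2 G, P G & graph_order G = n >].
Proof. by case=> G PG; exists (graph_order G); apply/asboolP; exists G. Qed.

Definition min_order (P : graph -> Prop) (exP : exists G, P G) : nat :=
  ex_minn (order_exists exP).

(* The infinite k-regular tree: vertices are the words over 'I_k with no two
   equal consecutive letters, the parent of i :: u being u, so that the root
   [::] has k children and every other vertex has k - 1. *)
Definition tree_vertex (k : nat) (u : seq 'I_k) : bool :=
  sorted (fun i j => i != j) u.

Definition tree_adj (k : nat) (u v : seq 'I_k) : bool :=
  [&& tree_vertex u, tree_vertex v &
      [exists i : 'I_k, (v == i :: u) || (u == i :: v)]].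

(* A walk is given by the vertices following its starting point, here the
   root (the tree is vertex-transitive). A walk of length l from the root only
   visits words of length at most l, so l.-bseq 'I_k loses no walk. *)
Definition tree_closed_walks (l k : nat) : nat :=
  #|[set p : l.-tuple (l.-bseq 'I_k) |
      let w := [seq val u | u <- p] in
      path (@tree_adj k) [::] w && (last [::] w == [::])]|.

(* Main.v *)
(* Fix a vertex v and let h = g/2. A walk of length l from v reduces to a
   non-backtracking walk, and the number of walks with a given reduction of
   length m is the number of walks of length l in the k-regular tree between
   two given vertices at distance m. A non-empty closed non-backtracking walk has
   length at least g, with equality exactly when it runs once around a g-cycle;
   rooted oriented g-cycles at v number s. Hence v has c(l) closed walks of
   length l < g, and c(g) + s of length g.
   Let B x be the number of walks of length h from v to x. Then B v = c(h),
   the sum of B x is k^h and the sum of (B x)^2 is c(g) + s, so Cauchy-Schwarz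
   over a set S, v not in S, supporting B away from v gives
   (k^h - c(h))^2 <= |S| (c(g) - c(h)^2 + s).
   Take S to be everything but v or, in the bipartite case, the part reached in
   h steps, minus v. *)
Require Import Defs.
From mathcomp Require Import all_boot all_order all_algebra.
From mathcomp Require Import ring zify.

Set Implicit Arguments.
Unset Strict Implicit.
Unset Printing Implicit Defensive.

Import Order.TTheory GRing.Theory Num.Theory.

(** * Walks in the regular tree, counted by depth *)

Lemma card_tupleS (T : finType) n (P : pred (seq T)) :
  #|[set t : n.+1.-tuple T | P t]| =
  \sum_x #|[set t : n.-tuple T | P (x :: t)]|.
Proof.
under eq_bigr => x _ do rewrite -sum1_card.
rewrite -sum1_card pair_big_dep /=.
rewrite (reindex (fun xt : T * n.-tuple T => [tuple of xt.1 :: xt.2])) /=.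
  by apply: eq_bigl => -[x t]; rewrite !inE.
exists (fun t => (thead t, [tuple of behead t])) => [[x t]|t] _ /=.
  by congr pair; apply: val_inj.
by rewrite [RHS]tuple_eta; apply: val_inj.
Qed.

(* The number of walks of length l from depth d to the root in the k-regular
   tree. *)
Fixpoint tree_walks_at (k l d : nat) : nat :=
  if l is l'.+1 then
    if d is d'.+1 then tree_walks_at k l' d' + k.-1 * tree_walks_at k l' d.+1
    else k * tree_walks_at k l' 1
  else d == 0.

Lemma tree_walks_at_gt k l d : l < d -> tree_walks_at k l d = 0.
Proof.
elim: l d => [|l IHl] [|d] //= ltld.
by rewrite !IHl ?muln0 // ltnW // ltnW.
Qed.

Lemma tree_walks_at_diag k l : tree_walks_at k l l = 1.
Proof. by elim: l => //= l ->; rewrite tree_walks_at_gt ?muln0 // ltnW. Qed.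

Lemma tree_walks_at_odd k l d : odd (l + d) -> tree_walks_at k l d = 0.
Proof.
elim: l d => [|l IHl] [|d] //=; rewrite ?addn0 => odd_ld.
  by rewrite IHl ?muln0 // addn1.
by rewrite !IHl ?muln0 // ?addnS /= ?negbK; move: odd_ld; rewrite addnS /= negbK.
Qed.

Lemma card_tree_children k (u : seq 'I_k) :
  tree_vertex u ->
  #|[set i | tree_vertex (i :: u)]| = if nilp u then k else k.-1.
Proof.
rewrite /tree_vertex; case: u => [|j u] /= hu.
  by rewrite -[RHS]card_ord -cardsT; apply: eq_card => i; rewrite !inE.
rewrite -[in RHS](card_ord k) -cardsT (cardsD1 j) inE add1n /=.
by apply: eq_card => i; rewrite !inE hu !andbT.
Qed.

(** The neighbours of a word are its one-letter extensions and, unless it is the root, its tail.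
    Since [size u < L], the extensions still fit in [L.-bseq]. *)
Lemma sum_tree_adj k L (u : seq 'I_k) (f : nat -> nat) :
    tree_vertex u -> size u < L ->
  \sum_(x : L.-bseq 'I_k | tree_adj u x) f (size x) =
  if nilp u then k * f 1 else f (size u).-1 + k.-1 * f (size u).+1.
Proof.
move=> tu ltuL; rewrite (bigID (fun x : L.-bseq 'I_k => size u < size x)) /=.
have -> : \sum_(x : L.-bseq 'I_k | tree_adj u x && (size u < size x)) f (size x)
   = (if nilp u then k else k.-1) * f (size u).+1.
  rewrite -(card_tree_children tu).
  pose h i : L.-bseq 'I_k := insubd [bseq] (i :: u).
  have hE i : val (h i) = i :: u by rewrite val_insubd /= ltuL.
  rewrite -(card_imset _ (f := h)); last first.
    by move=> i j /(congr1 val); rewrite !hE => -[].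
  rewrite -sum_nat_const; apply: eq_big => [x|x].
    apply/andP/imsetP => [[]|[i]].
      rewrite /tree_adj => /and3P[_ tx /existsP[i]] /orP[]/eqP E ltx.
        by exists i; [rewrite inE -E | apply: val_inj; rewrite hE].
      by move: ltx; rewrite E /= ltnNge leqnSn.
    rewrite inE => ti ->; rewrite hE /=; split=> //.
    by rewrite /tree_adj tu ti; apply/existsP; exists i; rewrite eqxx.
  rewrite /tree_adj => /andP[/and3P[_ _ /existsP[i]] /orP[]/eqP E].
    by rewrite E.
  by rewrite E /= ltnNge leqnSn.
(* The neighbours no longer than [u] remain: none at the root, only the tail otherwise. *)
case: u tu ltuL => [|j u] tu ltuL /=.
  rewrite big1 ?addn0 // => x /andP[/and3P[_ _ /existsP[i]]].
  by rewrite /= orbF => /eqP->.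
rewrite addnC; congr (_ + _).
have tu' : tree_vertex u by move: tu; rewrite /tree_vertex /=; apply: path_sorted.
pose x : L.-bseq 'I_k := insubd [bseq] u.
have xE : val x = u by rewrite val_insubd (ltnW (ltnW ltuL)).
rewrite (big_pred1 x) ?xE // => y; rewrite -leqNgt /tree_adj tu /=.
apply/andP/eqP => [[/andP[ty /existsP[i /orP[]/eqP E]]]|->].
- by rewrite E /= ltnn.
- by move=> _; apply: val_inj; rewrite xE; case: E.
rewrite xE tu' leqnSn; split=> //=.
by apply/existsP; exists j; rewrite eqxx orbT.
Qed.

(** The start is an arbitrary word so that the induction on [l] can move it by one step;
    [size u + l <= L] keeps the whole walk within [L.-bseq]. *)
Lemma card_tree_walks k L l (u : seq 'I_k) :
    tree_vertex u -> size u + l <= L ->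
  #|[set p : l.-tuple (L.-bseq 'I_k) |
      path (@tree_adj k) u [seq val x | x <- p]
      && (last u [seq val x | x <- p] == [::])]| = tree_walks_at k l (size u).
Proof.
elim: l u => [|l IHl] u tu leL /=.
  rewrite size_eq0; case: eqP => [->|neu].
    rewrite -[RHS](expn0 #|{: L.-bseq 'I_k}|) -card_tuple -cardsT.
    by apply: eq_card => p; rewrite !inE tuple0.
  by apply: eq_card0 => p; rewrite !inE tuple0 /=; apply/eqP.
rewrite (card_tupleS _ (fun p : seq (L.-bseq 'I_k) =>
  path (@tree_adj k) u [seq val x | x <- p]
  && (last u [seq val x | x <- p] == [::]))).
rewrite (bigID (fun x : L.-bseq 'I_k => tree_adj u x)) /= [X in _ + X]big1 ?addn0.
  rewrite (eq_bigr (fun x : L.-bseq 'I_k => tree_walks_at k l (size x))).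
    rewrite sum_tree_adj //; last by apply: leq_trans leL; rewrite -addSnnS leq_addr.
    by case: (u) => //= j u'.
  move=> x uv; rewrite -IHl.
  - by apply: eq_card => p; rewrite !inE uv.
  - by case/and3P: uv.
  case/and3P: uv => _ _ /existsP[i /orP[]/eqP E].
    by rewrite E /= addSnnS.
  by apply: leq_trans leL; rewrite E /= addSnnS leq_add2l ltnW.
by move=> x /negbTE uv; apply: eq_card0 => p; rewrite !inE uv.
Qed.

Lemma tree_closed_walksE l k : tree_closed_walks l k = tree_walks_at k l 0.
Proof. by rewrite -(@card_tree_walks k l l [::]). Qed.

(** * Walks in a graph and their non-backtracking reductions *)

Fixpoint walks (G : graph) (l : nat) (x y : G) : nat :=
  if l is l'.+1 then \sum_(u | adj x u) walks l' u y else x == y.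

(* A non-backtracking walk from x whose first step does not lead to o. *)
Fixpoint nb_walk (G : graph) (o : option G) (x : G) (p : seq G) : bool :=
  if p is y :: p' then [&& adj x y, Some y != o & nb_walk (Some x) y p']
  else true.

Definition nb_walks (G : graph) (m : nat) (o : option G) (x y : G) : nat :=
  #|[set p : m.-tuple G | nb_walk o x p && (last x p == y)]|.

Section Walks.

Variable G : graph.
Implicit Types (x y z u v w : G) (o : option G).

Lemma walksD l m x z :
  walks (l + m) x z = \sum_y walks l x y * walks m y z.
Proof.
elim: l x => [|l IHl] x /=.
  rewrite (bigD1 x) //= eqxx mul1n big1 ?addn0 // => y /negbTE.
  by rewrite eq_sym => ->.
under eq_bigr => u _ do rewrite IHl.
rewrite exchange_big; apply: eq_bigr => y _ /=.
by rewrite big_distrl.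
Qed.

Lemma walks1 x y : walks 1 x y = adj x y.
Proof.
rewrite /= big_mkcond (bigD1 y) //= eqxx big1 ?addn0; first by case: adj.
by move=> u /negbTE ->; case: adj.
Qed.

Lemma walks_sym l x y : walks l x y = walks l y x.
Proof.
elim: l x y => [|l IHl] x y; first by rewrite /= eq_sym.
rewrite -addn1 walksD addnC walksD; apply: eq_bigr => u _.
by rewrite IHl mulnC !walks1 adj_sym.
Qed.

Lemma sum_walks k l x : regular k G -> \sum_y walks l x y = k ^ l.
Proof.
move=> regG; elim: l x => [|l IHl] x /=.
  rewrite (bigD1 x) //= eqxx big1 ?addn0 // => y /negbTE.
  by rewrite eq_sym => ->.
rewrite exchange_big /=; under eq_bigr => u _ do rewrite IHl.
by rewrite sum_nat_const expnS -(regG x); congr (_ * _); apply: eq_card => y; rewrite !inE.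
Qed.

Lemma walks_side (A : {set G}) l x y :
    (forall x y, adj x y -> (x \in A) != (y \in A)) ->
    walks l x y != 0 ->
  (y \in A) = (x \in A) (+) odd l.
Proof.
move=> bipA; elim: l x => [|l IHl] x /=.
  by rewrite addbF eqb0 negbK => /eqP ->.
rewrite sum_nat_eq0 negb_forall => /existsP[u]; rewrite negb_imply => /andP[xu].
by move/IHl=> ->; move: (bipA _ _ xu); case: (x \in A); case: (u \in A); case: odd.
Qed.

(** Each side's size times [k] counts the edges across the bipartition. *)
Lemma bipartite_balanced k (A : {set G}) :
    0 < k -> regular k G ->
    (forall x y, adj x y -> (x \in A) != (y \in A)) ->
  #|A| = #|~: A|.
Proof.
move=> k0 regG bipA.
have side (B : {set G}) : #|B| * k = \sum_(x in B) \sum_y adj x y.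
  rewrite -sum_nat_const; apply: eq_bigr => x _.
  rewrite -(regG x) -sum1_card big_mkcond; apply: eq_bigr => y _.
  by rewrite inE; case: adj.
apply/eqP; rewrite -(eqn_pmul2r k0) !side; apply/eqP.
have cut (B : {set G}) :
    (forall x y, adj x y -> (x \in B) != (y \in B)) ->
  \sum_(x in B) \sum_y adj x y = \sum_(x in B) \sum_(y in ~: B) adj x y.
  move=> bipB; apply: eq_bigr => x xB; rewrite [RHS]big_mkcond.
  apply: eq_bigr => y _; rewrite inE; case: ifP => //.
  by case xy: (adj x y) => //; move: (bipB _ _ xy); rewrite xB; case: (y \in B).
rewrite cut // (cut (~: A)) => [|x y /bipA]; last by rewrite !inE; do 2 case: (_ \in A).
rewrite setCK exchange_big; apply: eq_bigr => x _; apply: eq_bigr => y _ /=.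
by rewrite adj_sym.
Qed.

Lemma nb_walks0 o x y : nb_walks 0 o x y = (x == y).
Proof.
rewrite /nb_walks; case: eqP => [->|nexy].
  rewrite -[RHS](expn0 #|G|) -card_tuple -cardsT.
  by apply: eq_card => p; rewrite !inE tuple0; apply: eqxx.
by apply: eq_card0 => p; rewrite !inE tuple0 /=; apply/eqP.
Qed.

Lemma nb_walksS m o x y :
  nb_walks m.+1 o x y =
  \sum_(u | adj x u && (Some u != o)) nb_walks m (Some x) u y.
Proof.
rewrite /nb_walks.
rewrite (card_tupleS _ (fun p : seq G => nb_walk o x p && (last x p == y))).
rewrite [RHS]big_mkcond; apply: eq_bigr => u _ /=.
case: ifP => [/andP[xu uo]|/negbT nuo].
  by apply: eq_card => p; rewrite !inE xu uo.
apply: eq_card0 => p; rewrite !inE.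
by case: (adj x u) nuo => //=; case: (Some u != o).
Qed.

Lemma nb_walksS_free m x y :
  nb_walks m.+1 None x y = \sum_(u | adj x u) nb_walks m (Some x) u y.
Proof. by rewrite nb_walksS; apply: eq_bigl => u; rewrite andbT. Qed.

(** A step to [u] followed by a non-backtracking walk either stays non-backtracking or returns at
    once to [x]; in the latter case the two steps cancel and leave a walk from [x] that does not
    start towards [u]. *)
Lemma sum_adj_nb_walks m x y :
  \sum_(u | adj x u) nb_walks m.+1 None u y =
  nb_walks m.+2 None x y + \sum_(u | adj x u) nb_walks m (Some u) x y.
Proof.
rewrite nb_walksS_free -big_split; apply: eq_bigr => u xu /=.
rewrite nb_walksS_free (bigD1 x) /=; last by rewrite adj_sym.
by rewrite nb_walksS addnC; congr (_ + _); apply: eq_bigl => z.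
Qed.

Lemma card_adj k x : regular k G -> #|[pred u | adj x u]| = k.
Proof. by move=> regG; rewrite -(regG x); apply: eq_card => y; rewrite !inE. Qed.

(** A walk with first step [z] is counted once for every neighbour [u] of [x] other than [z]; the
    empty walk is counted for all [k] of them. *)
Lemma sum_back_nb_walks k m x y : regular k G ->
  \sum_(u | adj x u) nb_walks m (Some u) x y =
  (if m is 0 then k else k.-1) * nb_walks m None x y.
Proof.
move=> regG; case: m => [|m].
  under eq_bigr => u _ do rewrite nb_walks0.
  by rewrite sum_nat_const (card_adj x regG) nb_walks0.
under eq_bigr => u _ do rewrite nb_walksS.
rewrite (exchange_big_dep (adj x)) /= => [|u z _ /andP[]//].
rewrite nb_walksS_free big_distrr; apply: eq_bigr => z xz /=.
rewrite sum_nat_const; congr (_ * _).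
rewrite -(card_adj x regG) [in RHS](cardD1 z) inE xz add1n.
apply: eq_card => u; rewrite !inE unfold_in andbC; congr (_ && _).
by rewrite eq_sym.
Qed.

(** Induction on the first step, which lengthens or shortens the reduction by one, just as a step in
    the tree changes the depth. Any [M > l] serves, as the coefficients vanish for [m > l]. *)
Lemma walks_nb_walks k l M x y : regular k G -> l < M ->
  walks l x y = \sum_(m < M) tree_walks_at k l m * nb_walks m None x y.
Proof.
move=> regG; elim: l M x => [|l IHl] [|M] x //.
  by move=> _; rewrite big_ord_recl nb_walks0 mul1n big1 ?addn0.
rewrite ltnS => ltlM; rewrite /=.
under eq_bigr => u _ do rewrite (IHl M.+2 _ (leqW (leqW ltlM))).
rewrite exchange_big /=.
under eq_bigr => m _ do rewrite -big_distrr /=.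
rewrite big_ord_recl [RHS]big_ord_recl /=.
have bump0 i : bump 0 i = i.+1 by [].
under [X in _ + X = _]eq_bigr => m _ do
  rewrite bump0 sum_adj_nb_walks (sum_back_nb_walks _ _ _ regG) mulnDr.
rewrite big_split /= addnA.
(* The lengthening steps give the summand [tree_walks_at k l' d'] of the tree recursion; the indices
   [M] and [M.+1] drop out, being above [l]. *)
have -> : tree_walks_at k l 0 * (\sum_(u | adj x u) nb_walks 0 None u y) +
    \sum_(m < M.+1) tree_walks_at k l m.+1 * nb_walks m.+2 None x y =
  \sum_(m < M) tree_walks_at k l m * nb_walks m.+1 None x y.
  transitivity (\sum_(m < M.+2) tree_walks_at k l m * nb_walks m.+1 None x y).
    rewrite [RHS]big_ord_recl; congr (_ * _ + _).
    by rewrite nb_walksS_free; apply: eq_bigr => u _; rewrite !nb_walks0.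
  rewrite !big_ord_recr /= !tree_walks_at_gt //; last exact: ltnW.
  by rewrite !mul0n !addn0.
(* The shortening steps carry [k] for the empty reduction and [k.-1] otherwise, as in the two
   branches of [tree_walks_at]. *)
rewrite addnC big_ord_recl /= -addnA mulnA (mulnC _ k); congr (_ + _).
rewrite -big_split; apply: eq_bigr => m _ /=.
by rewrite !bump0 add0n mulnDl addnC mulnCA mulnA.
Qed.

(** * Non-backtracking closed walks and cycles *)

Lemma nb_walk_path o x (p : seq G) : nb_walk o x p -> path (@adj G) x p.
Proof. by elim: p o x => //= y p IHp o x /and3P[-> _ /IHp]. Qed.

(** Take the last position whose vertex occurs again later: the segment up to that next occurrence
    has no other repetition and is a cycle, listed with its root at the end. *)
Lemma nb_walk_cycle o x (p : seq G) :
    nb_walk o x p -> ~~ uniq (x :: p) ->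
  exists p1 c p2, p = p1 ++ c ++ p2 /\ is_cycle c.
Proof.
elim: p o x => [|y p IHp] o x // nbyp.
case: (boolP (uniq (y :: p))) => [Up|nUp _]; last first.
  have /and3P[_ _ nbp] := nbyp.
  have [p1 [c [p2 [-> cc]]]] := IHp _ _ nbp nUp.
  by exists (y :: p1), c, p2.
rewrite cons_uniq Up andbT negbK inE; case: eqP => [xy|_ /= xp].
  by case/and3P: nbyp; rewrite -xy adj_irr.
case/splitPr: xp nbyp Up => q1 q2 nbyp Up.
exists [::], (y :: rcons q1 x), q2; rewrite /= cat_rcons; split=> //.
rewrite /is_cycle /ucycleb (cycle_path x) /= last_rcons size_rcons.
apply/and3P; split.
(* An empty [q1] would mean the backtracking [x], [y], [x]. *)
- by case: q1 nbyp {Up} => //=; rewrite eqxx !andbF.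
- by move/nb_walk_path: nbyp; rewrite -cat_rcons -cat_cons cat_path /= => /andP[].
by move: Up; rewrite -cat_rcons -cat_cons cat_uniq => /andP[].
Qed.

Lemma path_nb_walk z x (p : seq G) :
  path (@adj G) x p -> uniq [:: z, x & p] -> nb_walk (Some z) x p.
Proof.
elim: p z x => [|y p IHp] z x //= /andP[xy yp] /and3P[].
rewrite !inE !negb_or => /and3P[_ zy _] /andP[xnyp xnp] Up.
rewrite xy /=; apply/andP; split.
  by apply: contra zy => /eqP[->].
by apply: IHp => //; rewrite /= inE negb_or xnyp xnp.
Qed.

Lemma cycle_nb_walk x (p : seq G) :
  is_cycle p -> last x p = x -> nb_walk None x p.
Proof.
case: p => [|y [|u [|z p]]] // /andP[_ /andP[]].
rewrite (cycle_path x) => + Up lastx; rewrite lastx => /and3P[xy yu up].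
have nb := @path_nb_walk y u (z :: p) up Up; move: lastx Up nb.
rewrite /= => lastx /and3P[_ unzp _] ->.
rewrite xy yu !andbT; apply: contra unzp => /eqP[->].
by rewrite -lastx mem_last.
Qed.

Lemma nb_walks_lt_girth g m x :
  has_girth g G -> 0 < m < g -> nb_walks m None x x = 0.
Proof.
move=> [_ girthG] /andP[m0 mg]; apply: eq_card0 => t; rewrite !inE.
apply: contraTF mg => /andP[nbt /eqP lastt]; rewrite -leqNgt.
have [] := nb_walk_cycle nbt _.
  case: t lastt nbt m0 => -[|y p] /= /eqP <- // lastx _ _.
  by rewrite negb_and negbK -{1}lastx mem_last.
move=> p1 [c [p2 [tE /girthG]]] /leq_trans -> //.
by rewrite -(size_tuple t) tE !size_cat addnCA leq_addr.
Qed.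

Lemma nb_walks_girth g x : has_girth g G ->
  nb_walks g None x x =
  #|[set t : g.-tuple G | is_cycle t && (last x t == x)]|.
Proof.
move=> [[c0 cc0 <-] girthG]; apply: eq_card => t; rewrite !inE.
apply: andb_id2r => /eqP lastt; apply/idP/idP => [nbt|/cycle_nb_walk]; last exact.
have nUt : ~~ uniq (x :: t).
  have: 0 < size t by rewrite size_tuple; case: (c0) cc0.
  case: (val t) lastt => // y p /= lastx _.
  by rewrite negb_and negbK -{1}lastx mem_last.
have [p1 [c [p2 [tE cc]]]] := nb_walk_cycle nbt nUt.
(* By the girth, the cycle inside the walk takes up its whole length. *)
have: size t <= size c by rewrite size_tuple girthG.
rewrite tE !size_cat addnCA -[leqRHS]addn0 leq_add2l leqn0 addn_eq0 !size_eq0.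
by case/andP=> /eqP-> /eqP->; rewrite cats0.
Qed.

(** * Cycles as edge sets versus rooted oriented cycles *)

Lemma cycle_mem_last x (c : seq G) : is_cycle c -> last x c = x -> x \in c.
Proof. by case: c => //= y p _ <-; rewrite mem_last. Qed.

Lemma cycle_edges_rot n (c : seq G) : uniq c -> cycle_edges (rot n c) = cycle_edges c.
Proof.
move=> Uc; apply/setP => e.
apply/imsetP/imsetP => -[x xc ->]; exists x;
  by rewrite ?next_rot ?mem_rot // -(mem_rot n).
Qed.

Lemma cycle_edges_rev (c : seq G) : uniq c -> cycle_edges (rev c) = cycle_edges c.
Proof.
move=> Uc; apply/setP => e; apply/imsetP/imsetP => -[x xc ->].
  exists (prev c x); first by rewrite mem_prev -mem_rev.
  by rewrite next_rev // next_prev // setUC.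
exists (next c x); first by rewrite mem_rev mem_next.
by rewrite next_rev // prev_next // setUC.
Qed.

Lemma mem_cycle_edges (c : seq G) x y :
  uniq c -> [set x; y] \in cycle_edges c ->
  x \in c /\ y = next c x \/ y \in c /\ x = next c y.
Proof.
move=> Uc /imsetP[z zc exy].
have xz : x \in [set z; next c z] by rewrite -exy set21.
have yz : y \in [set z; next c z] by rewrite -exy set22.
have zx : z \in [set x; y] by rewrite exy set21.
have nx : next c z \in [set x; y] by rewrite exy set22.
move: xz yz zx nx; rewrite !inE.
case/orP=> /eqP ->; case/orP => /eqP ->; rewrite ?orbb.
- by move=> _ /eqP zz; left; split.
- by left.
- by right.
by move=> /eqP zz _; left; rewrite -zz; split.
Qed.

Lemma next_next_neq (c : seq G) x :
  uniq c -> 2 < size c -> x \in c -> next c (next c x) != x.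
Proof.
move=> Uc lt2c xc; have [i p e] := rot_to xc.
move: (Uc) lt2c; rewrite -(size_rot i) -(rot_uniq i) -!(next_rot i Uc) e.
case: p {e} => [|y [|z p]] //=; rewrite !inE !negb_or.
move=> /and3P[/and3P[xy xz _] /andP[yz _] _] _.
by rewrite eqxx (eq_sym y x) (negbTE xy) eqxx eq_sym.
Qed.

(** The edge that [c] takes out of [next c x] also lies on [d]. If [d] ran along it the other way,
    its far end would be [x], against [next_next_neq]. *)
Lemma next_cycle_edges (c d : seq G) x :
    uniq c -> uniq d -> 2 < size c ->
    cycle_edges c = cycle_edges d -> x \in c -> next c x = next d x ->
  next c (next c x) = next d (next d x).
Proof.
move=> Uc Ud lt2 ecd xc nx; rewrite -nx.
have: [set next c x; next c (next c x)] \in cycle_edges d.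
  by rewrite -ecd; apply/imsetP; exists (next c x); rewrite ?mem_next.
case/(mem_cycle_edges Ud) => [[_ //]|[yd]]; rewrite nx => e.
have := next_next_neq Uc lt2 xc; rewrite -[X in _ != X](prev_next Ud) -nx.
by rewrite {2}nx e (prev_next Ud) nx eqxx.
Qed.

(** A cycle rooted at [x] is listed with [x] last, whereas iterating [next] from [x] puts it first;
    hence the rotation by one. *)
Lemma iter_next_rot (c : seq G) x :
  uniq c -> 0 < size c -> last x c = x ->
  c = rot 1 (traject (next c) x (size c)).
Proof.
case/lastP: c => // p y Uc _; rewrite last_rcons => yx; subst y.
have := cycle_next Uc; move: (next _) => f.
rewrite (cycle_path x) last_rcons => /(@fpathE _ f).
rewrite size_rcons trajectSr => /eqP; rewrite eqseq_rcons => /andP[/eqP E _].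
by rewrite [traject _ _ _]/= rot1_cons -E.
Qed.

(* An edge set, a root and a first step determine a cycle: after y -> z, the
   next step is the edge at z other than {y, z}. *)
Lemma cycle_edges_inj (c d : seq G) x :
    is_cycle c -> is_cycle d -> size c = size d ->
    last x c = x -> last x d = x -> next c x = next d x ->
    cycle_edges c = cycle_edges d ->
  c = d.
Proof.
move=> cc /andP[lt2d /andP[_ Ud]] ecd lc ld nx ec.
have /andP[lt2c /andP[_ Uc]] := cc.
rewrite (iter_next_rot Uc _ lc) ?(ltn_trans _ lt2c) //.
rewrite (iter_next_rot Ud _ ld) ?(ltn_trans _ lt2d) // -ecd; congr rot.
have xc : x \in c := cycle_mem_last cc lc.
have step i : [/\ iter i (next c) x \in c,
    iter i (next c) x = iter i (next d) x &
    iter i.+1 (next c) x = iter i.+1 (next d) x].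
  elim: i => [|i [ic ei ei1]]; first by split.
  split=> //; first by rewrite iterS mem_next.
  have e1 : next c (iter i (next c) x) = next d (iter i (next c) x).
    by rewrite {2}ei; apply: ei1.
  have := next_cycle_edges Uc Ud lt2c ec ic e1.
  by rewrite [in X in _ = X]ei.
apply: (@eq_from_nth _ x) => [|i]; rewrite !size_traject // => ilt.
by rewrite !nth_traject //; case: (step i).
Qed.

(** An edge set has exactly one listing rooted at [x] with first step [y]: a rotation, after a
    reversal if needed, produces it, and [cycle_edges_inj] makes it unique. *)
Lemma edge_cyclesE g x y :
  edge_cycles g x y =
  #|[set t : g.-tuple G | is_cycle t && (last x t == x) && (next t x == y)]|.
Proof.
rewrite /edge_cycles -(card_in_imset (f := @cycle_edges G \o val)); last first.
  move=> c d; rewrite !inE => /andP[/andP[cc /eqP lc] /eqP nc].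
  move=> /andP[/andP[cd /eqP ld] /eqP nd] ecd; apply: val_inj.
  by apply: (cycle_edges_inj cc cd _ lc ld _ ecd); rewrite ?nc ?size_tuple.
have rot_last (t : g.-tuple G) z : is_cycle t -> z \in t ->
    let t' := rot (index z t).+1 t in
    [/\ is_cycle t', last z t' = z, next t' z = next t z &
        cycle_edges t' = cycle_edges t].
  move=> /andP[lt2 /andP[ct Ut]] zt /=.
  rewrite /is_cycle /ucycleb size_rot rot_cycle rot_uniq ct Ut lt2.
  rewrite next_rot // cycle_edges_rot //; split=> //.
  by rewrite /rot last_cat (take_nth z) ?index_mem // last_rcons nth_index.
apply: eq_card => e; rewrite !inE; apply/andP/imsetP => [[]|[t]].
  move=> /imsetP[t]; rewrite inE => ct -> /mem_cycle_edges.
  have /andP[lt2 /andP[adjt Ut]] := ct.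
  case/(_ Ut) => [[xt ->]|[yt ->]].
    have [ct' lt' nt' et'] := rot_last t x ct xt.
    exists [tuple of rot (index x t).+1 t]; last by rewrite /= et'.
    by rewrite inE /= ct' lt' nt' !eqxx.
  (* Here [t] runs from [y] to [x = next t y], so it is reversed before being rotated. *)
  pose r := [tuple of rev t].
  have cr : is_cycle r.
    rewrite /is_cycle /ucycleb size_rev rev_uniq lt2 Ut rev_cycle andbT.
    by rewrite (eq_cycle (e' := @adj G)) // => u v; rewrite adj_sym.
  have nr : next t y \in r by rewrite mem_rev mem_next.
  have [ct' lt' nt' et'] := rot_last r _ cr nr.
  exists [tuple of rot (index (next t y) r).+1 r].
    by rewrite inE /= ct' lt' nt' next_rev // prev_next // !eqxx.
  by rewrite /= et' cycle_edges_rev.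
rewrite inE => /andP[/andP[ct /eqP lt] /eqP nt] -> /=; split.
  by apply/imsetP; exists t; rewrite ?inE.
apply/imsetP; exists x; last by rewrite nt.
exact: cycle_mem_last ct lt.
Qed.

(** Rooted oriented cycles are sorted by their first step; a cycle through [x] enters twice on both
    sides, once for each of its edges at [x]. *)
Lemma sum_edge_cycles g x :
  \sum_(y in neighbours x) edge_cycles g x y =
  #|[set t : g.-tuple G | is_cycle t && (last x t == x)]|.
Proof.
rewrite -[RHS]sum1_card (partition_big (fun t : g.-tuple G => next t x)
  [in neighbours x]) => [|t]; last first.
  rewrite !inE => /andP[ct /eqP lt]; have /andP[_ /andP[adjt _]] := ct.
  apply: (next_cycle adjt).
  exact: cycle_mem_last ct lt.
apply: eq_bigr => y _; rewrite edge_cyclesE -sum1_card.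
by apply: eq_bigl => t; rewrite !inE.
Qed.

Lemma sum_signature k g (a : k.-tuple nat) x : signature g x = a ->
  \sum_(i < k) tnth a i = \sum_(y in neighbours x) edge_cycles g x y.
Proof.
move=> sig; rewrite -(big_tuple _ _ _ xpredT (fun i => i)) -sig.
by rewrite (perm_big _ (permEl (perm_sort _ _))) big_map big_enum.
Qed.

(** * Closed walks of length at most the girth *)

Lemma closed_walks_lt_girth k g l x : regular k G -> has_girth g G -> l < g ->
  walks l x x = tree_closed_walks l k.
Proof.
move=> regG girthG ltlg; rewrite (walks_nb_walks _ _ regG (leqnn _)).
rewrite big_ord_recl nb_walks0 eqxx muln1 tree_closed_walksE big1 ?addn0 // => i _.
by rewrite (nb_walks_lt_girth _ girthG) ?muln0 //= (leq_ltn_trans _ ltlg) /bump.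
Qed.

Lemma closed_walks_girth k g (a : k.-tuple nat) x : girth_regular g a G ->
  walks g x x = tree_closed_walks g k + \sum_(i < k) tnth a i.
Proof.
case=> regG girthG /(_ x) /sum_signature ->.
rewrite sum_edge_cycles -nb_walks_girth // (walks_nb_walks _ _ regG (leqnn _)).
(* The case [g = 0] is void, a cycle having more than two vertices. *)
case: g girthG => [[[c /andP[+ _] c0]]|g girthG]; first by rewrite c0.
(* Only the reduced lengths 0 and [g] contribute, the latter with coefficient 1 by
   [tree_walks_at_diag]. *)
rewrite big_ord_recr big_ord_recl /= nb_walks0 eqxx muln1 tree_closed_walksE.
rewrite big1 ?addn0 => [|i _]; last first.
  by rewrite (nb_walks_lt_girth _ girthG) ?muln0 //= /bump add1n ltnS.
by have := tree_walks_at_diag k g.+1; rewrite /= => ->; rewrite mul1n.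
Qed.

End Walks.

(** * The Cauchy-Schwarz inequality and the bounds on the order *)

Local Open Scope ring_scope.

(** Multiplied by [#|S|], the defect is the sum over [S] of the squares of [#|S| * f x - s], a
    scaled variance. *)
Lemma sqr_sum_le_card (R : realFieldType) (T : finType) (S : {set T}) (f : T -> R) :
  (\sum_(x in S) f x) ^+ 2 <= #|S|%:R * \sum_(x in S) f x ^+ 2.
Proof.
set s := \sum_(x in S) f x; set q := \sum_(x in S) f x ^+ 2.
case: (posnP #|S|) => [/cards0_eq S0|S_gt0].
  by rewrite /s S0 big_set0 expr0n mulr_ge0 // sumr_ge0 // => x _; apply: sqr_ge0.
have N0 : 0 < #|S|%:R :> R by rewrite ltr0n.
suff: 0 <= #|S|%:R * (#|S|%:R * q - s ^+ 2) by rewrite pmulr_rge0 // subr_ge0.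
suff -> : #|S|%:R * (#|S|%:R * q - s ^+ 2) = \sum_(x in S) (#|S|%:R * f x - s) ^+ 2.
  by apply: sumr_ge0 => x _; apply: sqr_ge0.
have expand x : (#|S|%:R * f x - s) ^+ 2 =
    #|S|%:R ^+ 2 * f x ^+ 2 + (- (2 * #|S|%:R * s)) * f x + s ^+ 2 by ring.
under eq_bigr => x _ do rewrite expand.
rewrite !big_split /= -!mulr_sumr sumr_const -mulr_natl -/s -/q; ring.
Qed.

Lemma sum_even_power_support (G : graph) (k g : nat) (a : k.-tuple nat) (v : G)
    (S : {set G}) :
    girth_regular g a G -> ~~ odd g -> v \notin S ->
    (forall x, x != v -> x \notin S -> walks g./2 v x = 0%N) ->
  let c (l : nat) : rat := (tree_closed_walks l k)%:R in
  (k%:R ^+ g./2 - c g./2) ^+ 2 <=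
  #|S|%:R * (c g - c g./2 ^+ 2 + (\sum_(i < k) tnth a i)%N%:R).
Proof.
move=> grG /even_halfK geq vS supp /=.
pose c l : rat := (tree_closed_walks l k)%:R; have [regG girthG _] := grG.
set h := g./2 in geq supp *.
have hg : (h < g)%N.
  have [[t /andP[lt2 _] tg] _] := girthG.
  by rewrite -geq -addnn -[ltnLHS]addn0 ltn_add2l; case: (h) geq lt2 => //; rewrite tg => <-.
(* Serves for both moments, [F] being the identity or the square; [F 0 = 0] discards the vertices
   outside [S] and [v]. *)
have split (F : nat -> rat) : F 0%N = 0 ->
    \sum_x F (walks h v x) = F (tree_closed_walks h k) + \sum_(x in S) F (walks h v x).
  move=> F0; rewrite (bigD1 v) //= (closed_walks_lt_girth _ regG girthG hg).
  congr (_ + _); rewrite (bigID [in S]) /= [X in _ + X]big1 ?addr0.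
    apply: eq_bigl => x; rewrite andb_idl // => xS.
    by apply: contraNneq vS => <-.
  by move=> x /andP[xv xS]; rewrite supp.
have sum1 : \sum_(x in S) (walks h v x)%:R = k%:R ^+ h - c h :> rat.
  apply/eqP; rewrite eq_sym subr_eq addrC -(split (fun n => n%:R)) //.
  by rewrite -natr_sum (sum_walks _ _ regG) natrX.
have sum2 : \sum_(x in S) (walks h v x)%:R ^+ 2 =
    c g - c h ^+ 2 + (\sum_(i < k) tnth a i)%N%:R :> rat.
  rewrite addrAC; apply/eqP; rewrite eq_sym subr_eq [X in _ == X]addrC.
  have /= <- := split (fun n => n%:R ^+ 2).
    rewrite -natrD -(closed_walks_girth v grG) -geq -addnn walksD natr_sum.
    by apply/eqP/eq_bigr => x _; rewrite (walks_sym _ x v) natrM.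
  by rewrite expr0n.
by rewrite -sum1 -sum2; apply: sqr_sum_le_card.
Qed.

Lemma tree_closed_walks_odd k l : odd l -> tree_closed_walks l k = 0%N.
Proof. by move=> odd_l; rewrite tree_closed_walksE tree_walks_at_odd // addn0. Qed.


(** The side [P] is chosen to contain [v], so that the parity of [g./2] decides whether the walks of
    that length from [v] end in [P] or in its complement. *)
Lemma bipartition_of (k : nat) (G : graph) (v : G) :
    (0 < k)%N -> regular k G -> bipartite G ->
  exists P : {set G}, [/\ v \in P, (#|P| * 2 = #|G|)%N &
    forall l x, walks l v x != 0%N -> (x \in P) = ~~ odd l].
Proof.
move=> k_gt0 regG [A bipA]; have balA := bipartite_balanced k_gt0 regG bipA.
exists (if v \in A then A else ~: A); split.
- by case: ifP => // /negbT; rewrite inE.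
- by rewrite muln2 -addnn -(cardsC A); case: ifP; rewrite ?setCK balA.
move=> l x /(walks_side bipA); case: ifP => vA; rewrite ?inE => -> //.
Qed.

Lemma min_orderP (P : graph -> Prop) (exP : exists G, P G) :
  exists2 G, P G & graph_order G = min_order exP.
Proof. by rewrite /min_order; case: ex_minnP => n /boolp.asboolP. Qed.

(* The sign of D is irrelevant, since x / 0 = 0. *)
Lemma sqr_div_le (R : realFieldType) (x N D : R) :
  0 <= N -> x ^+ 2 <= N * D -> x ^+ 2 / D <= N.
Proof.
move=> N_ge0; case: (ltgtP D 0) => [D_lt0 _|D_gt0|-> _].
- by rewrite (le_trans _ N_ge0) // mulr_ge0_le0 ?sqr_ge0 // invr_le0 ltW.
- by rewrite ler_pdivrMr.
by rewrite invr0 mulr0.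
Qed.

(** The variant for a support from which [v] was removed: the [+ 1] restores [v]. For [D = 0] the
    quotient is again 0. *)
Lemma add_sqr_div_le (R : realFieldType) (x N D : R) :
  0 <= N -> x ^+ 2 <= N * D -> (D + x ^+ 2) / D <= N + 1.
Proof.
move=> N_ge0 xND; have [->|D_neq0] := eqVneq D 0.
  by rewrite invr0 mulr0 addr_ge0.
by rewrite mulrDl divff // addrC lerD2r sqr_div_le.
Qed.

Theorem theorem4p3 (k g : nat) (a : k.-tuple nat)
    (hk : (3 <= k)%N) (hg : ~~ odd g)
    (hn : exists G : graph, girth_regular g a G) :
  let n : rat := (min_order hn)%:R in
  let n2 (hn2 : exists G : graph, bip_girth_regular g a G) : rat :=
    (min_order hn2)%:R in
  let s : rat := (\sum_(i < k) tnth a i)%N%:R in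
  let c (l : nat) : rat := (tree_closed_walks l k)%:R in
  let K : rat := k%:R in
  ((g %% 4 = 0)%N ->
     (c g + s + K ^+ g - 2 * c g./2 * K ^+ g./2) / (c g - c g./2 ^+ 2 + s) <= n
     /\ forall hn2,
     2 * ((c g + s + K ^+ g - 2 * c g./2 * K ^+ g./2)
          / (c g - c g./2 ^+ 2 + s)) <= n2 hn2)
  /\
  ((g %% 4 = 2)%N ->
     (c g + s + K ^+ g) / (c g + s) <= n
     /\ forall hn2, 2 * K ^+ g / (c g + s) <= n2 hn2).
Proof.
move=> n n2 s c K; set D := c g - c g./2 ^+ 2 + s.
have Kg : K ^+ g = (K ^+ g./2) ^+ 2.
  by rewrite -exprM muln2 even_halfK.
have vertexP (G : graph) : girth_regular g a G -> exists v : G, true.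
  case=> _ [[t /andP[+ _] _] _] _; by case: t => // v; exists v.
have bound (G : graph) (v : G) := @sum_even_power_support G k g a v.
have k_gt0 : (0 < k)%N by apply: leq_trans hk.
have grn : forall (G : graph) (v : G), girth_regular g a G ->
    (K ^+ g./2 - c g./2) ^+ 2 <= (#|G|%:R - 1) * D /\ 1 <= #|G|%:R :> rat.
  move=> G v grG; have := bound G v [set~ v] grG hg.
  rewrite !inE eqxx => /(_ isT) H; rewrite (cardD1 v) inE natrD addrAC subrr add0r.
  split; last by rewrite lerDl.
  rewrite -[X in X%:R](_ : #|[set~ v]| = _).
    by apply: H => x xv; rewrite !inE xv.
  by apply: eq_card => x; rewrite !inE andbT.
split=> [g4|g2].
- have hodd : ~~ odd g./2 by lia.
  (* Completing the square shows the shape needed for [add_sqr_div_le]. *)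
  have numE : c g + s + K ^+ g - 2 * c g./2 * K ^+ g./2 =
      D + (K ^+ g./2 - c g./2) ^+ 2 by rewrite Kg /D; ring.
  rewrite numE; split.
    rewrite /n; have [G grG <-] := min_orderP hn.
    have [v _] := vertexP _ grG; have [H G1] := grn G v grG.
    rewrite -[leRHS](subrK 1); apply: add_sqr_div_le H.
    by rewrite subr_ge0.
  move=> hn2; rewrite /n2; have [G [grG bipG] <-] := min_orderP hn2.
  have [v _] := vertexP _ grG; have [regG _ _] := grG.
  have [P [vP PG Pwalk]] := bipartition_of v k_gt0 regG bipG.
  rewrite /graph_order -PG natrM mulrC ler_pM2r ?ltr0n //.
  rewrite (cardsD1 v) vP natrD [leRHS]addrC; apply: add_sqr_div_le => //.
  (* The support is [P] minus [v], since an even number of steps leads back to the side of [v]. *)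
  apply: (bound _ v) => //; first by rewrite !inE eqxx.
  move=> x xv; rewrite !inE xv /=; apply: contraNeq => /Pwalk ->.
  by [].
have hodd : odd g./2 by lia.
(* An odd walk in the tree cannot close up, so the terms in [c g./2] disappear. *)
have c0 : c g./2 = 0 by rewrite /c tree_closed_walks_odd.
have xE : K ^+ g = (K ^+ g./2 - c g./2) ^+ 2 by rewrite c0 subr0.
have DE : c g + s = D by rewrite /D c0 expr0n subr0.
rewrite DE; split.
  rewrite /n; have [G grG <-] := min_orderP hn.
  have [v _] := vertexP _ grG; have [H G1] := grn G v grG.
  rewrite xE -[leRHS](subrK 1); apply: add_sqr_div_le H.
  by rewrite subr_ge0.
move=> hn2; rewrite /n2; have [G [grG bipG] <-] := min_orderP hn2.
have [v _] := vertexP _ grG; have [regG _ _] := grG.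
have [P [vP PG Pwalk]] := bipartition_of v k_gt0 regG bipG.
(* An odd number of steps leads to the side opposite [v]; no vertex has to be removed from it, which
   is why this bound lacks the extra summand in the numerator. *)
have CPG : (2 * #|~: P| = #|G|)%N by have := cardsC P; lia.
rewrite /graph_order -CPG natrM -mulrA ler_pM2l ?ltr0n // xE.
apply: sqr_div_le => //; apply: (bound _ v) => //; first by rewrite inE vP.
move=> x _; rewrite inE negbK; apply: contraTeq => /Pwalk ->.
by rewrite hodd.
Qed.
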